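(* Let $k\geq 1$ be an integer and let $a=[a_0;a_1,\dots,a_{k-1}]$ be the even- or odd-length continued fraction expansion of a positive rational number (so $a_0\geq 0$ and $a_i\geq 1$ for $1\leq i<k$). Let $(r_i)$ be defined by $r_{-1}=r_0=1$ and $r_i=a_{i-1}r_{i-1}+r_{i-2}$ for $1\leq i\leq k$. Let $\mathcal{Z}(a)=\mathbb{Z}\cap[0,r_k)$ if $k$ is odd and $\mathcal{Z}(a)=\mathbb{Z}\cap[r_{k-1}-r_k,\,r_{k-1})$ if $k$ is even. Then every integer $n\in\mathcal{Z}(a)$ can be written uniquely as \[ n=\sum_{i=0}^{k-1}(-1)^i b_i r_i \] where $(b_i)_{0\leq i\leq k-1}$ is an admissible sequence for $a$.
   Context: A finite sequence of integers $(b_i)_{0\leq i<k}$ is called admissible for $a=[a_0;\dots,a_{k-1}]$ if: (i) $0\leq b_i\leq a_i$ for every $0\leq i<k$; (ii) if $i>0$ is odd and $b_i=a_i$, then $b_{i-1}=a_{i-1}$; (iii) if $i>0$ is even and $b_i=0$, then $b_{i-1}=0$. (Equivalently, $r_i=p_{i-1}+q_{i-1}$ where $p_j/q_j$ are the convergents of $a$ with $p_{-1}=1,q_{-1}=0$.) *)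

(* Defs.v *)
From HB Require Import structures.
From mathcomp Require Import all_boot all_order all_algebra.
Set Implicit Arguments.
Unset Strict Implicit.
Unset Printing Implicit Defensive.
Import Order.TTheory GRing.Theory Num.Theory.
Local Open Scope ring_scope.

(* [a_0; a_1, ..., a_{k-1}].  On a one-term list the recursive call is 0, and
   0^-1 = 0 in MathComp, so cf_val [:: c] = c. *)
Fixpoint cf_val (a : seq int) : rat :=
  if a is c :: s then c%:~R + (cf_val s)^-1 else 0.

(* The last term is allowed to be 1, so that a positive rational has exactly
   two expansions, one of even and one of odd length. *)
Definition cf_expansion (a : seq int) (x : rat) : Prop :=
  [/\ (0 < size a)%N,
      forall i : nat, (0 < i < size a)%N -> 1 <= a`_i
    & cf_val a = x].

(* Index shifted by one: rS a j is r_{j-1}, since the sequence r starts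
   at index -1. *)
Fixpoint rS (a : seq int) (j : nat) : int :=
  match j with
  | 0 => 1
  | 1 => 1
  | (j'.+1 as j1).+1 => a`_j' * rS a j1 + rS a j'
  end.

Definition r (a : seq int) (i : nat) : int := rS a i.+1.

Definition Zset (a : seq int) : pred int := fun n =>
  let k := size a in
  if odd k then 0 <= n < r a k else r a k.-1 - r a k <= n < r a k.-1.

Definition admissible (a b : seq int) : Prop :=
  [/\ size b = size a,
      forall i : nat, (i < size a)%N -> 0 <= b`_i <= a`_i,
      forall i : nat, (0 < i < size a)%N -> odd i ->
        b`_i = a`_i -> b`_i.-1 = a`_i.-1
    & forall i : nat, (0 < i < size a)%N -> ~~ odd i ->
        b`_i = 0 -> b`_i.-1 = 0].

(* Main.v *)
Require Import Defs.
From HB Require Import structures.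
From mathcomp Require Import all_boot all_order all_algebra.
From mathcomp Require Import ring zify.
Set Implicit Arguments.
Unset Strict Implicit.
Unset Printing Implicit Defensive.
Import Order.TTheory GRing.Theory Num.Theory.
Local Open Scope ring_scope.

(** Replacing [b_i] by [d_i = a_i - b_i] at even indices turns admissibility
    into the single rule "if [d_i = a_i] then [d_{i-1} = 0]", and turns the
    alternating sum into [E - \sum_i d_i r_i] with
    [E = \sum_(i even) a_i r_i].  The constant [E] telescopes to [r_k - 1]
    (k odd) or [r_{k-1} - 1] (k even), so that [n] is in [Zset a] iff
    [0 <= E - n < r_k].  What remains is the Ostrowski numeration of the
    integers of [[0, r_k)]: digits are found greedily, a maximal digit leaving
    a remainder less than [r_{i-1}] and so forcing the next one to vanish, and
    are unique because [\sum_(i < j) d_i r_i < r_j] for every [j]. *)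

Definition positive_terms (a : seq int) : Prop :=
  forall i, (i < size a)%N -> (0 < i)%N%:Z <= a`_i.

Definition ostrowski (a : seq int) (k : nat) (d : nat -> int) : Prop :=
  (forall i, (i < k)%N -> 0 <= d i <= a`_i) /\
  (forall i, (i.+1 < k)%N -> d i.+1 = a`_i.+1 -> d i = 0).

Lemma ostrowskiW (a : seq int) (k : nat) (d : nat -> int) :
  ostrowski a k.+1 d -> ostrowski a k d.
Proof.
by case=> d_bnd d_rule; split=> i ik; [apply: d_bnd | apply: d_rule]; lia.
Qed.

Lemma rS_bounds (a : seq int) (j : nat) :
  positive_terms a -> (j <= size a)%N -> 1 <= rS a j <= rS a j.+1.
Proof.
move=> a_pos; elim: j => [|j IHj] // ja.
have {IHj} := IHj (ltnW ja); have := a_pos j ja.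
rewrite -/(a`_j * rS a j.+1 + rS a j).
(* [a_0] may be 0, which is harmless because r_{-1} = r_0 = 1; later terms are at least 1. *)
case: j ja => [|j] ja /=; nia.
Qed.

Lemma r_rec (a : seq int) (k : nat) : r a k.+1 = a`_k * r a k + rS a k.
Proof. by []. Qed.

(** If the top digit is not maximal, the sum is below (a_k - 1) r_k + r_k < r_{k+1}. If it is
    maximal, the digit below it vanishes, so the rest stays below r_{k-1}, exactly the slack in
    r_{k+1} = a_k r_k + r_{k-1}. Hence an induction reaching back two steps. *)
Lemma ostrowski_sum_bounds (a : seq int) (k : nat) (d : nat -> int) :
  positive_terms a -> (k <= size a)%N -> ostrowski a k d ->
  0 <= \sum_(i < k) d i * r a i < r a k.
Proof.
move=> a_pos; elim/ltn_ind: k => -[|k] IHk ka d_ost; first by rewrite big_ord0.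
have [d_bnd d_rule] := d_ost.
have := IHk k (ltnSn k) (ltnW ka) (ostrowskiW d_ost).
have := d_bnd k (ltnSn k); have := rS_bounds a_pos (ltnW ka).
rewrite big_ord_recr r_rec -/(r a k) => /= r_bnd dk S_bnd.
have [dka|dka] := eqVneq (d k) a`_k; last first.
  by set c := a`_k in dk dka *; set S := \sum_(i < k) _ in S_bnd *; nia.
case: k => [|k] in IHk ka d_ost d_bnd d_rule r_bnd dk S_bnd dka *.
  (* A single maximal digit has nothing below it: the slack is r_{-1} = 1. *)
  by move: S_bnd r_bnd; rewrite big_ord0 dka; nia.
have dk0 := d_rule k (ltnSn _) dka.
have := IHk k (ltnW (ltnSn _)) (ltnW (ltnW ka)) (ostrowskiW (ostrowskiW d_ost)).
rewrite -[rS a k.+1]/(r a k) big_ord_recr /= dk0 mul0r addr0 dka addrC.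
set S := \sum_(i < k) _; set c := a`_k.+1 in dk dka *; nia.
Qed.

(** The lower digits sum to an element of [0, r_k), so the top digit is the quotient of the total by
    r_k. *)
Lemma ostrowski_unique (a : seq int) (k : nat) (d e : nat -> int) :
  positive_terms a -> (k <= size a)%N -> ostrowski a k d -> ostrowski a k e ->
  \sum_(i < k) d i * r a i = \sum_(i < k) e i * r a i ->
  forall i, (i < k)%N -> d i = e i.
Proof.
move=> a_pos; elim: k => [//|k IHk] ka /ostrowskiW d_ost /ostrowskiW e_ost.
have := ostrowski_sum_bounds a_pos (ltnW ka) d_ost.
have := ostrowski_sum_bounds a_pos (ltnW ka) e_ost.
rewrite !big_ord_recr /=.
move: (IHk (ltnW ka) d_ost e_ost).
set S := \sum_(i < k) _; set T := \sum_(i < k) _ => IH T_bnd S_bnd eqST.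
have dek : d k = e k by nia.
have {}eqST : S = T by nia.
move=> i; rewrite ltnS leq_eqVlt => /orP[/eqP -> //|]; exact: IH.
Qed.

Lemma ostrowski_exists (a : seq int) (k : nat) (m : int) :
  positive_terms a -> (k <= size a)%N -> 0 <= m < r a k ->
  exists2 d, ostrowski a k d & m = \sum_(i < k) d i * r a i.
Proof.
move=> a_pos; elim: k m => [|k IHk] m ka m_bnd.
  exists (fun=> 0); first by split.
  by rewrite big_ord0; move: m_bnd; rewrite /r /=; lia.
have r_bnd := rS_bounds a_pos (ltnW ka).
have r_gt0 : 0 < r a k by rewrite /r; lia.
have q_def := divz_eq m (r a k).
have s_ge0 : 0 <= (m %% r a k)%Z by apply: modz_ge0; lia.
have s_lt : (m %% r a k)%Z < r a k by apply: ltz_pmod.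
have m_lt : m < a`_k * r a k + rS a k by case/andP: m_bnd.
move: s_ge0 s_lt q_def.
set q := (m %/ _)%Z; set s := (m %% _)%Z => s_ge0 s_lt q_def.
have [|d d_ost s_def] := IHk s (ltnW ka); first by rewrite s_ge0.
have [d_bnd d_rule] := d_ost.
exists (fun i => if i == k then q else d i); last first.
  rewrite big_ord_recr /= eqxx q_def addrC s_def; congr (_ + _).
  by apply: eq_bigr => i _; rewrite ltn_eqF.
split=> i ik.
  case: eqVneq => [->|ik']; last by apply: d_bnd; lia.
  (* The quotient is at most [a_k] because m < a_k r_k + r_{k-1} <= (a_k + 1) r_k. *)
  by rewrite /r in s_ge0 s_lt q_def m_lt m_bnd *; nia.
rewrite (ltn_eqF (_ : (i < k)%N)) //.
case: eqVneq => [ik' qa|ik']; last by apply: d_rule; lia.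
have s_lt' : s < r a i.
  rewrite /r ik'; rewrite qa ik' in q_def.
  by set c := a`_k in q_def m_lt *; lia.
have /andP[di_ge0 _] := d_bnd i ik.
have i_size : (i <= size a)%N by lia.
(* The digits below [i] contribute a nonnegative amount, so d_i r_i <= s < r_i, which forces d_i =
   0. *)
have : 0 <= \sum_(j < i) d j * r a j < r a i.
  by apply: ostrowski_sum_bounds => //; apply: ostrowskiW; rewrite ik'.
have {}s_def : s = \sum_(j < i.+1) d j * r a j by rewrite s_def ik'.
move: s_def; rewrite big_ord_recr /=.
by set S := \sum_(j < i) _; nia.
Qed.

Definition flip_even (a : seq int) (b : nat -> int) (i : nat) : int :=
  if odd i then b i else a`_i - b i.

(** Neighbouring indices have opposite parity, so exactly one of the two digits in each rule is
    flipped: the odd rule flips its conclusion, the even rule its premise. *)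
Lemma admissible_ostrowski (a b : seq int) :
  size b = size a ->
  admissible a b <-> ostrowski a (size a) (flip_even a (nth 0 b)).
Proof.
move=> ab; rewrite /flip_even; split=> [[_ b_bnd b_odd b_even]|[d_bnd d_rule]].
  split=> [i ia|i ia /=]; first by have := b_bnd i ia; case: ifP; lia.
  have := b_odd i.+1 ia; have := b_even i.+1 ia => /=.
  case: (odd i) => /= even_rule odd_rule di.
    apply: even_rule => //; move: di.
    by set c := a`_i.+1; set e := b`_i.+1; lia.
  by rewrite odd_rule // subrr.
split=> // [i ia|[//|i] ia iO bi|[//|i] ia iE bi].
- by have := d_bnd i ia; case: ifP; lia.
- have := d_rule i ia; rewrite iO; move: iO => /= /negbTE -> /(_ bi)/eqP.
  by rewrite subr_eq0 => /eqP ->.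
- have := d_rule i ia; rewrite (negbTE iE); move: iE => /=.
  by rewrite negbK => ->; apply; rewrite bi subr0.
Qed.

Definition even_sum (a : seq int) (k : nat) : int :=
  \sum_(i < k | ~~ odd i) a`_i * r a i.

(** Since a_i r_i = r_{i+1} - r_{i-1}, the sum telescopes down to -r_{-1} = -1. *)
Lemma even_sumE (a : seq int) (k : nat) :
  even_sum a k = (if odd k then r a k else rS a k) - 1.
Proof.
rewrite /even_sum; elim: k => [|k IHk]; first by rewrite big_ord0.
rewrite big_mkcond big_ord_recr -big_mkcond IHk /=.
by case: (odd k) => /=; rewrite /r /=; lia.
Qed.

Lemma alternating_sumE (a : seq int) (b : nat -> int) (k : nat) :
  \sum_(i < k) (-1) ^+ i * b i * r a i =
  even_sum a k - \sum_(i < k) flip_even a b i * r a i.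
Proof.
rewrite /even_sum [X in X - _]big_mkcond -sumrB; apply: eq_bigr => i _.
by rewrite -signr_odd /flip_even; case: (odd i) => /=; ring.
Qed.

Lemma mem_Zset (a : seq int) (n : int) :
  (0 < size a)%N ->
  (n \in Zset a) = (0 <= even_sum a (size a) - n < r a (size a)).
Proof.
rewrite even_sumE unfold_in /Zset; case: (size a) => [//|k] _.
rewrite -[rS a k.+1]/(r a k).
by case: (odd _); move: (r a k) (r a k.+1) => p q; lia.
Qed.

Theorem theoremA (k : nat) (hk : (1 <= k)%N) (a : k.-tuple int) (x : rat)
    (hx : 0 < x) (ha : cf_expansion a x) (ha0 : 0 <= a`_0)
    (n : int) (hn : n \in Zset a) :
  exists! b : k.-tuple int,
    admissible a b /\ n = \sum_(i < k) (-1) ^+ i * b`_i * r a i.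
Proof.
have a_size : size a = k := size_tuple a.
have a_pos : positive_terms a.
  by case: ha => _ a_ge1 _ [|i] ia //; apply: a_ge1.
have := hn; rewrite mem_Zset a_size // => m_bnd.
have k_le : (k <= size a)%N by rewrite a_size.
have [d d_ost m_def] := ostrowski_exists a_pos k_le m_bnd.
(* Flipping is an involution, so the flip of this [b] is [d] again. *)
pose b := [tuple flip_even a d i | i < k].
have bE i : (i < k)%N -> flip_even a (nth 0 b) i = d i.
  move=> ik; rewrite /flip_even (_ : b`_i = flip_even a d i).
    by rewrite /flip_even; case: (odd i); rewrite ?subKr.
  by rewrite -(tnth_nth 0 b (Ordinal ik)) tnth_mktuple.
have b_ost : ostrowski a k (flip_even a (nth 0 b)).
  case: d_ost => d_bnd d_rule; split=> i ik; rewrite !bE //; try exact: ltnW.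
  - exact: d_bnd.
  - exact: d_rule.
have b_sum : \sum_(i < k) flip_even a (nth 0 b) i * r a i = even_sum a k - n.
  by rewrite m_def; apply: eq_bigr => i _; rewrite bE.
exists b; split.
  split; last by rewrite alternating_sumE b_sum subKr.
  by apply/admissible_ostrowski; rewrite ?size_tuple // -{1}a_size.
move=> b' [/admissible_ostrowski]; rewrite !size_tuple => /(_ erefl) b'_ost.
rewrite alternating_sumE => n_def.
have eq_bb' i : (i < k)%N ->
    flip_even a (nth 0 b) i = flip_even a (nth 0 b') i.
  apply: (ostrowski_unique a_pos k_le b_ost b'_ost).
  by rewrite b_sum n_def subKr.
apply: eq_from_tnth => i; rewrite !(tnth_nth 0).
have := eq_bb' i (ltn_ord i); rewrite /flip_even.
by case: ifP => _ // /addrI /oppr_inj.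
Qed.
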